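(* Let $G$ be a finite, simple, undirected, connected graph without isolated vertices. Then $\chi_{ON}(G)\le {\sf fvs}(G)+2$.
   Context: A CFON coloring of a graph $G=(V,E)$ using $k$ colors is an assignment $C:V(G)\to\{1,\dots,k\}$ such that for every $v\in V(G)$ there exists $i\in\{1,\dots,k\}$ with $|N(v)\cap C^{-1}(i)|=1$, where $N(v)$ is the open neighborhood of $v$. $\chi_{ON}(G)$ is the smallest number of colors required for a CFON coloring of $G$. A feedback vertex set of $G$ is a set $S\subseteq V$ such that $G[V\setminus S]$ is acyclic; ${\sf fvs}(G)$ is the size of a smallest feedback vertex set of $G$. *)

(* Defs.v *)
From mathcomp Require Import all_boot.

Set Implicit Arguments.
Unset Strict Implicit.
Unset Printing Implicit Defensive.

(* A finite simple graph is a symmetric irreflexive relation on a finType. *)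

Section Graph.
Variable V : finType.
Implicit Types (e : rel V) (v : V) (S : {set V}).

Definition nbhd e v : {set V} := [set u | e v u].

Definition connected_graph e : bool :=
  (0 < #|V|) && [forall x, forall y, connect e x y].

Definition no_isolated e : bool := [forall v, nbhd e v != set0].

(* The colors 1, ..., k are encoded by 'I_k. *)
Definition CFON_coloring e (k : nat) (C : {ffun V -> 'I_k}) : bool :=
  [forall v, exists i : 'I_k, #|nbhd e v :&: C @^-1: [set i]| == 1].

Definition CFON_colorable e (k : nat) : bool :=
  [exists C : {ffun V -> 'I_k}, CFON_coloring e C].

Lemma CFON_colorable_ex e : no_isolated e -> exists k, CFON_colorable e k.
Proof.
move=> /forallP noiso; exists #|V|; apply/existsP.
exists [ffun v => enum_rank v]; apply/forallP => v.
have [u uv] := set0Pn _ (noiso v).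
apply/existsP; exists (enum_rank u); apply/cards1P; exists u.
apply/setP => w; rewrite !inE ffunE (inj_eq enum_rank_inj).
by case: eqP => [->|_]; rewrite ?andbT ?andbF //; move: uv; rewrite inE.
Qed.

(* A graph with an isolated vertex has no CFON coloring at all, so the CFON
   chromatic number takes the absence of isolated vertices as an argument. *)
Definition chi_ON e (noiso : no_isolated e) : nat :=
  ex_minn (CFON_colorable_ex noiso).

(* A cycle is a duplicate-free sequence of at least 3 vertices, cyclically
   adjacent.  Its length is at most #|V|, which makes acyclicity decidable. *)
Definition acyclic e : bool :=
  [forall n : 'I_#|V|.+1, forall c : n.-tuple V, (2 < n) ==> ~~ ucycleb e c].

Lemma acyclicP e :
  reflect (forall c : seq V, 2 < size c -> ~ ucycle e c) (acyclic e).
Proof.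
apply: (iffP forallP) => [ac c c3 /[dup] uc /andP[_ un] | ac n].
  have lc : size c < #|V|.+1 by rewrite ltnS -(card_uniqP un) max_card.
  have /forallP/(_ (in_tuple c))/implyP/(_ c3) := ac (Ordinal lc).
  by rewrite [ucycleb e _]uc.
apply/forallP => c; apply/implyP => n3; apply/negP.
by apply: ac; rewrite size_tuple.
Qed.

(* The subgraph of e induced on the vertex set A. *)
Definition induced e (A : {set V}) : rel {x : V | x \in A} :=
  relpre val e.

End Graph.

Section FeedbackVertexSet.
Variables (V : finType) (e : rel V).

Definition feedback_vertex_set (S : {set V}) : bool :=
  acyclic (@induced V e (~: S)).

Lemma feedback_vertex_setT : feedback_vertex_set [set: V].
Proof.
by apply/acyclicP => -[|[x xP] c] //; exfalso; move: xP; rewrite setCT inE.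
Qed.

(* Well defined by feedback_vertex_setT. *)
Definition fvs : nat :=
  #|[arg min_(S < [set: V] | feedback_vertex_set S) #|S|]|.

Lemma fvsP :
  (exists2 S, feedback_vertex_set S & #|S| = fvs) /\
  (forall S, feedback_vertex_set S -> fvs <= #|S|).
Proof.
rewrite /fvs; case: arg_minnP => [|S fS minS]; first exact: feedback_vertex_setT.
by split; first exists S.
Qed.

End FeedbackVertexSet.

(* Main.v *)
(* Let S be a feedback vertex set, F = V \ S and U the set of vertices of S
   without neighbour in S.  The forest F is coloured with two colours, by removing
   leaves, and the vertices of S \ U get further distinct colours.  The vertices s
   of U, whose neighbours are all in F, are then added one by one, each with a
   fresh colour c.  If s has no uniquely coloured neighbour, give c to s and to
   one neighbour w of s: this satisfies every vertex adjacent to exactly one of s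
   and w, so it can only fail if some common neighbour of s and w relied on w
   alone.  If it fails for every w, a counting argument shows that each neighbour
   of s relies on another neighbour of s.  Since a colour outside the two
   forest colours occurs at most once in F, none is seen by s, so s can be
   given any old one of them, and a single w the colour c.  When S = U no such
   old colour exists for the first s; there one 2-colours F \ w instead of F, and
   if this fails for every w, the neighbours of s induce a union of isolated edges
   of F, which can be coloured freely. *)
Require Import Defs.
From mathcomp Require Import all_boot zify.

Set Implicit Arguments.
Unset Strict Implicit.
Unset Printing Implicit Defensive.

Section ConflictFree.
Variables (V : finType) (e : rel V).
Hypotheses (e_sym : symmetric e) (e_irr : irreflexive e).
Implicit Types (A F N S U : {set V}) (f : V -> nat) (m : nat).

(** * Acyclic vertex sets and their leaves *)

(** Phrased on sequences over [V] instead of the sigma type of [induced], so that [A] can shrink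
    without a change of type. *)
Definition acyclic_in A :=
  forall c : seq V, 2 < size c -> {subset c <= A} -> ~ ucycle e c.

Lemma acyclic_inS (A B : {set V}) : A \subset B -> acyclic_in B -> acyclic_in A.
Proof. by move=> /subsetP AB acB c c3 cA; apply: acB => // x /cA /AB. Qed.

Lemma fvs_acyclic_in S : feedback_vertex_set e S -> acyclic_in (~: S).
Proof.
move=> /acyclicP acS c c3 cS; have: all (mem (~: S)) c by apply/allP.
case/all_sigP=> c' def_c; rewrite def_c => /andP[cyc un].
apply: (acS c'); first by rewrite def_c size_map in c3.
by rewrite /ucycle -(map_inj_uniq val_inj) un andbT -cycle_map.
Qed.

(** Starting from an edge, a path in [A] could be prolonged at its front forever: the extra
    neighbour [z] of its first vertex is either new or closes a cycle. *)
Lemma leafless_acyclic_in A :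
  acyclic_in A ->
  (forall x y, x \in A -> y \in A -> e x y ->
     exists z, [/\ z \in A, e x z & z != y]) ->
  forall x y, x \in A -> y \in A -> ~~ e x y.
Proof.
move=> acA leafless x0 y0 x0A y0A; apply/negP => exy0.
have long n : exists x y p, [/\ size p = n, path e x (y :: p),
    uniq (x :: y :: p) & {subset x :: y :: p <= A}].
  elim: n => [|n [x [y [p [szp exp unp pA]]]]].
    exists x0, y0, [::]; split=> //=; first by rewrite exy0.
      by rewrite inE andbT; apply: contraTneq exy0 => ->; rewrite e_irr.
    by move=> z; rewrite !inE => /orP[] /eqP ->.
  have [xA yA] : x \in A /\ y \in A by rewrite !pA ?inE ?eqxx ?orbT.
  have exy : e x y by case/andP: exp.
  have [z [zA exz zy]] := leafless x y xA yA exy.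
  have zx : z != x by apply: contraTneq exz => ->; rewrite e_irr.
  case zp: (z \in p).
    case/splitPr: p / zp szp exp unp pA => p1 p2 _ exp unp pA.
    case: (acA (x :: y :: rcons p1 z)) => //.
    - by rewrite /= size_rcons.
    - move=> t tp; apply: pA; move: tp.
      rewrite !inE mem_rcons mem_cat !inE.
      by case/or4P=> ->; rewrite ?orbT.
    - apply/andP; split.
        move: exp; rewrite /= rcons_path last_rcons rcons_path cat_path /=.
        by rewrite [e z x]e_sym exz => /and4P[-> -> -> _].
      move: unp; rewrite -cat_rcons -!cat_cons cat_uniq.
      by case/andP.
  exists z, x, (y :: p); split.
  - by rewrite /= szp.
  - by rewrite [path _ _ _]/= e_sym exz.
  - by rewrite cons_uniq unp andbT !inE zp (negbTE zx) (negbTE zy).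
  - by move=> t; rewrite inE => /predU1P[->|/pA].
have [x [y [p [szp _ /card_uniqP un _]]]] := long #|V|.
by have := max_card (mem (x :: y :: p)); rewrite un /= szp => /ltnW; rewrite ltnn.
Qed.

(** * Uniquely coloured neighbours, and the two-colouring of forests *)

Definition relies f A v x :=
  [&& x \in A, e v x & [forall y in A, e v y ==> (f y == f x) ==> (y == x)]].

Lemma reliesP f A v x :
  reflect [/\ x \in A, e v x &
             forall y, y \in A -> e v y -> f y = f x -> y = x]
          (relies f A v x).
Proof.
apply: (iffP and3P) => [[xA vx /forall_inP un]|[xA vx un]]; split=> //.
  by move=> y yA vy fyx; have /implyP/(_ vy)/implyP := un y yA;
     rewrite fyx eqxx => /(_ isT)/eqP.
apply/forall_inP => y yA; apply/implyP=> vy; apply/implyP=> /eqP fyx.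
by apply/eqP/un.
Qed.

(** Vertices without neighbour in [A] are exempt, so that forests with isolated vertices qualify. *)
Definition cf_on f A :=
  forall v x, v \in A -> x \in A -> e v x -> exists y, relies f A v y.

(** Only its neighbour [p] sees a leaf [v], so the colour of [v] can be chosen for the sake of [p]
    alone. Without leaves there are no edges, and a constant colouring does. *)
Lemma forest_two_coloring A :
  acyclic_in A -> exists2 f, forall v, f v < 2 & cf_on f A.
Proof.
have [n] := ubnP #|A|; elim: n A => // n IHn A ltAn acA.
case: (pickP [pred xy : V * V | [&& xy.1 \in A, xy.2 \in A, e xy.1 xy.2 &
    [forall z in A, e xy.1 z ==> (z == xy.2)]]]) => [[v p]|noleaf] /=; last first.
  exists (fun=> 0) => // v0 x0 v0A x0A v0x0; suff /negP[] : ~~ e v0 x0 by [].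
  apply: (leafless_acyclic_in acA) => // v x vA xA vx.
  have := noleaf (v, x); rewrite /= vA xA vx /= => /negbT.
  case/forall_inPn=> z zA; rewrite negb_imply => /andP[vz zx].
  by exists z.
case/and4P=> vA pA vp /forall_inP leaf.
have {}leaf z : z \in A -> e v z -> z = p.
  by move=> zA vz; apply/eqP; have /implyP -> := leaf z zA.
have [|f f2 cf] := IHn (A :\ v) _ (acyclic_inS (subsetDl _ _) acA).
  by move: ltAn; rewrite (cardsD1 v A) vA; lia.
(* Colour the leaf [v] differently from the vertex on which [p] relies. *)
have [x px] : exists x, relies f (A :\ v) p x \/
    (forall y, y \in A -> e p y -> y = v).
  case: (pickP [pred y in A :\ v | e p y]) => [y /andP[yA py]|no].
    have [|x px] := cf p y _ yA py; last by exists x; left.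
    by rewrite !inE pA andbT; apply: contraTneq vp => ->; rewrite e_irr.
  (* A dummy witness: [p] has no other neighbour, so it will rely on [v] whatever the colour of
     [v]. *)
  exists v; right=> y yA py; apply/eqP/negPn/negP => yv.
  by have := no y; rewrite !inE yv yA py.
exists (fun u => if u == v then 1 - f x else f u) => [u|].
  by case: ifP => // _; rewrite ltnS leq_subr.
move=> u y uA yA uy; case: (eqVneq u v) => [->|uv].
  exists p; apply/reliesP; split=> // z zA vz _; exact: leaf.
case: (eqVneq u p) => [up|np].
  subst u; case: px => [/reliesP[]|only]; last first.
    by exists v; apply/reliesP; split=> //; [rewrite e_sym | move=> z zA /only ->].
  rewrite !inE => /andP[xv xA] px un; exists x; apply/reliesP; split=> //.
  move=> z zA pz; rewrite (negbTE xv); case: eqVneq => [->|zv].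
    by have := f2 x; lia.
  by apply: un => //; rewrite !inE zv.
have nvu z : z \in A -> e u z -> z != v.
  move=> zA; apply: contraTneq => ->; apply: contra np; rewrite e_sym => vu.
  exact/eqP/leaf.
have [||t /reliesP[]] := cf u y _ _ uy; first by rewrite !inE uv.
  by rewrite !inE nvu.
rewrite !inE => /andP[tv tA] ut un; exists t; apply/reliesP; split=> // z zA uz.
rewrite (negbTE tv) (negbTE (nvu z zA uz)); apply: un => //.
by rewrite !inE zA nvu.
Qed.

(** * Adding one vertex at the cost of one fresh colour *)

(** Choosing such a [u] for each [w] maps [N] into itself, injectively by the second hypothesis,
    hence onto since [N] is finite. *)
Lemma injective_dependency N (Q : rel V) :
  (forall w, w \in N -> exists2 u, u \in N & Q w u) ->
  (forall w w' u, Q w u -> Q w' u -> w = w') ->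
  forall u, u \in N -> exists2 w, w \in N & Q w u.
Proof.
move=> exQ funQ u uN.
pose r w := odflt w [pick u in N | Q w u].
have rP w : w \in N -> r w \in N /\ Q w (r w).
  move=> wN; rewrite /r; case: pickP => [x /andP[]//|no].
  by have [x xN Qx] := exQ w wN; have := no x; rewrite xN Qx.
have rN : r @: N = N.
  apply/eqP; rewrite eqEcard; apply/andP; split.
    by apply/subsetP=> _ /imsetP[w /rP[? _] ->].
  rewrite card_in_imset // => w w' /rP[_ Qw] /rP[_ Qw'] eq_r.
  by apply: funQ Qw _; rewrite eq_r.
move: uN; rewrite -{1}rN => /imsetP[w wN ->]; exists w => //.
by case: (rP w wN).
Qed.

(* Colours [0] and [1] are reserved for the forest [F]; every other colour
   occurs at most once in [F]. *)
Definition extendable F A m := exists f,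
  [/\ forall v, v \in A -> f v < m, cf_on f A &
      forall x y, x \in F -> y \in F -> 1 < f x -> f x = f y -> x = y].

(* [s] gets colour [d] and [w] the fresh colour [m]; the last hypothesis concerns
   the vertices that do not see [m] exactly once. *)
Lemma extend_recolor F A m f s w d :
  F \subset A -> s \notin A -> w \in A -> e s w -> 1 < m -> d <= m ->
  (forall v, v \in A :\ w -> f v < m) ->
  (forall x y, x \in F :\ w -> y \in F :\ w -> 1 < f x -> f x = f y -> x = y) ->
  (forall v y, v \in A -> y \in s |: A -> e v y ->
     e v w = (d == m) && e v s ->
     exists2 x, relies f (A :\ w) v x & e v s -> f x != d) ->
  extendable F (s |: A) m.+1.
Proof.
move=> /subsetP FA sA wA sw m2 dm fm f1 cf.
have sx x : x \in A -> (x == s) = false by move=> xA; apply: contraNF sA => /eqP <-.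
have fnm x : x \in A -> x != w -> f x != m.
  by move=> xA xw; rewrite neq_ltn fm // !inE xw.
pose g v := if v == s then d else if v == w then m else f v.
have gs : g s = d by rewrite /g eqxx.
have gw : g w = m by rewrite /g sx // eqxx.
have gx x : x \in A -> x != w -> g x = f x.
  by move=> xA xw; rewrite /g sx // (negbTE xw).
exists g; split.
- move=> v /setU1P[->|vA]; first by rewrite gs ltnS.
  case: (eqVneq v w) => [->|vw]; first by rewrite gw.
  by rewrite gx // ltnW // ltnS fm // !inE vw.
- move=> v y vA yA vy.
  (* Colour [m] sits on [w], and on [s] exactly when [d = m]; so [v] sees it exactly once iff these
     two Booleans differ. *)
  have [bad|good] := eqVneq (e v w) ((d == m) && e v s); last first.
    have [dvs|dvs] := boolP ((d == m) && e v s);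
      rewrite ?dvs ?(negbTE dvs) /= in good.
      case/andP: dvs => /eqP dm' vs; exists s; apply/reliesP.
      rewrite gs; split=> [||z /setU1P[//|zA vz]]; rewrite ?inE ?eqxx //.
      case: (eqVneq z w) vz => [->|zw _]; first by case: (e v w) good.
      by rewrite gx // dm' => /eqP; rewrite (negbTE (fnm _ _ _)).
    have vw : e v w by case: (e v w) good.
    exists w; apply/reliesP; rewrite gw inE wA orbT; split=> // z.
    case/setU1P=> [->|zA vz].
      by rewrite gs => vs dm'; rewrite dm' eqxx vs in dvs.
    case: (eqVneq z w) => // zw; rewrite gx // => /eqP.
    by rewrite (negbTE (fnm _ _ _)).
  case: (eqVneq v s) bad => [->|vs bad].
    by rewrite sw e_irr andbF.
  have {}vA : v \in A by case/setU1P: vA => // /eqP; rewrite (negbTE vs).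
  have [x /reliesP[xA vx unx] fxd] := cf v y vA yA vy bad.
  have [xw {}xA] : x != w /\ x \in A by move: xA; rewrite !inE => /andP[].
  exists x; apply/reliesP; rewrite (gx x) // inE xA orbT; split=> // z.
  case/setU1P=> [-> /fxd|zA vz].
    by rewrite gs => /eqP fxd' dx; rewrite dx in fxd'.
  case: (eqVneq z w) => [->|zw].
    by rewrite gw => mx; have := fnm x xA xw; rewrite mx eqxx.
  by rewrite gx //; apply: unx => //; rewrite !inE zw.
- move=> x y xF yF; have xA := FA x xF; have yA := FA y yF.
  case: (eqVneq x w) => [->|xw]; case: (eqVneq y w) => [->|yw] //.
  + by rewrite gw gx // => _ my; have := fnm y yA yw; rewrite my eqxx.
  + by rewrite gw gx // => _ my; have := fnm x xA xw; rewrite my eqxx.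
  + by rewrite !gx //; apply: f1; rewrite !inE ?xw ?yw.
Qed.

(** The fresh colour [m] goes to [s], alone or together with a neighbour [w]. Failing both, [s]
    takes colour 2, which is old because [2 < m], and a neighbour takes [m]. *)
Lemma extend_vertex F A m s :
  F \subset A -> s \notin A -> 2 < m ->
  (exists2 x, x \in A & e s x) ->
  (forall x, x \in A -> e s x -> x \in F) ->
  extendable F A m -> extendable F (s |: A) m.+1.
Proof.
move=> /subsetP FA sA m3 [x0 x0A sx0] sF [f [fm cf f1]].
have neqs x : x \in A -> x != s by apply: contraTneq => ->.
case: (pickP (relies f A s)) => [x /reliesP[xA sx unx]|unhappy].
  exists (fun v => if v == s then m else f v); split.
  - by move=> v /setU1P[->|vA]; rewrite ?eqxx //
      (negbTE (neqs v vA)) ltnW ?ltnS ?fm.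
  - move=> v y; case: (eqVneq v s) => [-> _ _ _|vs]; last case vsE: (e v s).
    + exists x; apply/reliesP; split; rewrite ?inE ?xA ?orbT // => z.
      case/setU1P=> [->|zA]; first by rewrite e_irr.
      by rewrite (negbTE (neqs z zA)) (negbTE (neqs x xA)); apply: unx.
    + move=> /setU1P[/eqP|vA _ _]; first by rewrite (negbTE vs).
      exists s; apply/reliesP; split; rewrite ?inE ?eqxx // => z.
      case/setU1P=> [//|zA _]; rewrite (negbTE (neqs z zA)) => fz.
      by have := fm z zA; lia.
    + move=> /setU1P[/eqP|vA]; first by rewrite (negbTE vs).
      move=> /setU1P[->|yA vy]; first by rewrite vsE.
      have [t /reliesP[tA vt unt]] := cf v y vA yA vy.
      exists t; apply/reliesP; split; rewrite ?inE ?tA ?orbT // => z.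
      case/setU1P=> [->|zA]; first by rewrite vsE.
      by rewrite (negbTE (neqs z zA)) (negbTE (neqs t tA)); apply: unt.
  - move=> y z yF zF; rewrite (negbTE (neqs y (FA y yF))).
    by rewrite (negbTE (neqs z (FA z zF))); apply: f1.
pose N := [set x in A | e s x].
(* A vertex [w] can share [m] with [s] if each common neighbour of the two relies on some vertex
   other than [w]. *)
have [w /andP[wN good]|allbad] := pickP [pred w in N |
   [forall u in N, e u w ==> [exists x in A :\ w, relies f A u x]]].
  have [wA sw] : w \in A /\ e s w by move: wN; rewrite inE => /andP[].
  apply: (@extend_recolor F A m f s w m) => //; rewrite ?eqxx ?(ltnW m3) //.
  - by apply/subsetP.
  - by move=> v /setD1P[_ /fm].
  - by move=> x y /setD1P[_ xF] /setD1P[_ yF]; apply: f1.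
  move=> v y vA /setU1P y_or vy /= vws.
  have [vw|nvw] := boolP (e v w).
    have vN : v \in N by rewrite inE vA e_sym -vws.
    have /forall_inP/(_ v vN)/implyP/(_ vw)/exists_inP[x] := good.
    move=> xA /reliesP[_ vx unx]; exists x.
      by apply/reliesP; split=> // z /setD1P[_]; apply: unx.
    by move=> _; rewrite neq_ltn fm //; case/setD1P: xA.
  rewrite (negbTE nvw) in vws.
  have {y_or} yA : y \in A by case: y_or => // ys; rewrite -ys vy in vws.
  have [x /reliesP[xA vx unx]] := cf v y vA yA vy; exists x; last by rewrite -vws.
  apply/reliesP; split=> //; last by move=> z /setD1P[_]; apply: unx.
  by rewrite !inE xA andbT; apply: contraNneq nvw => <-.
have dep v : v \in N -> exists2 w, w \in N & relies f A v w.
  (* [Q w u] makes [w] the only vertex on which [u] relies. Each failing [w] yields such a [u] in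
     [N]; counting reverses the roles. *)
  pose Q w u := [&& w \in A, e u w, u \in A &
    ~~ [exists x in A :\ w, relies f A u x]].
  have QP w u : Q w u -> forall x, relies f A u x -> x = w.
    case/and4P=> _ _ _ /exists_inPn no x ux; apply/eqP/negPn/negP => xw.
    by have := no x; rewrite ux !inE xw; case/reliesP: ux => -> _ _ /(_ isT).
  have Qrel w u : Q w u -> relies f A u w.
    move=> /[dup] /QP Qw /and4P[wA uw uA _].
    by have [x ux] := cf u w uA wA uw; rewrite -(Qw x ux).
  move=> vN; have [||w wN /Qrel] :=
    injective_dependency (N := N) (Q := Q) _ _ vN.
  - move=> w wN; have := allbad w; rewrite /= wN /= => /negbT/forall_inPn[u' u'N].
    rewrite negb_imply => /andP[u'w no]; exists u' => //.
    by move: wN u'N; rewrite /Q !inE u'w no => /andP[-> _] /andP[-> _].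
  - by move=> w w' u' /Qrel Qw /QP; apply.
  by exists w.
(* A neighbour of colour 2 would lie in [F], where this colour occurs at most once, so [s] would
   rely on it. *)
have sN2 x : x \in N -> f x != 2.
  rewrite inE => /andP[xA sx]; apply/eqP => fx2.
  have := unhappy x; case/negP; apply/reliesP; split=> // y yA sy fyx.
  by apply: f1; rewrite ?sF // ?fyx fx2.
(* A vertex of [N] not adjacent to [x0] relies on a member of [N] other than [x0], whose colour is
   not 2. *)
apply: (@extend_recolor F A m f s x0 2) => //; rewrite ?(ltnW m3) //.
- by apply/subsetP.
- by move=> v /setD1P[_ /fm].
- by move=> x y /setD1P[_ xF] /setD1P[_ yF]; apply: f1.
move=> v y vA y_or vy; rewrite (ltn_eqF m3) /= => nvx0.
have [vs|nvs] := boolP (e v s).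
  have [|w wN /reliesP[wA vw unw]] := dep v; first by rewrite inE vA e_sym.
  exists w; last by rewrite sN2.
  apply/reliesP; split=> //; last by move=> z /setD1P[_]; apply: unw.
  by rewrite !inE wA andbT; apply: contraFneq nvx0 => <-.
have yA : y \in A by case/setU1P: y_or => // ys; rewrite -ys vy in nvs.
have [x /reliesP[xA vx unx]] := cf v y vA yA vy; exists x => //.
apply/reliesP; split=> //; last by move=> z /setD1P[_]; apply: unx.
by rewrite !inE xA andbT; apply: contraFneq nvx0 => <-.
Qed.

(** The third colour goes to [s] and some [w], over a two-colouring of [F :\ w], or, if no [w]
    allows this, to [s] alone. *)
Lemma extend_forest F s :
  acyclic_in F -> s \notin F -> (exists2 x, x \in F & e s x) ->
  extendable F (s |: F) 3.
Proof.
move=> acF sF [w0 w0F sw0].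
pose N := [set x in F | e s x].
(* Here [u] need only keep some neighbour in [F :\ w], since the two-colouring is taken on [F :\ w]
   afterwards. *)
have [w /andP[wN good]|allbad] := pickP [pred w in N |
   [forall u in N, e u w ==> [exists x in F :\ w, e u x]]].
  have [wF sw] : w \in F /\ e s w by move: wN; rewrite inE => /andP[].
  have [f f2 cf] := forest_two_coloring (acyclic_inS (subsetDl F [set w]) acF).
  apply: (@extend_recolor F F 2 f s w 2) => //; rewrite ?eqxx //.
    by move=> x y _ _ fx1; have := f2 x; rewrite ltnNge fx1.
  move=> v y vF y_or vy /= vws.
  have fxd x : e v s -> f x != 2 by move=> _; rewrite neq_ltn f2.
  have vw : v != w.
    by apply: contraTneq sw => vw; move: vws; rewrite vw e_irr [e w s]e_sym => <-.
  have vFw : v \in F :\ w by rewrite !inE vw.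
  have [ew|nvw] := boolP (e v w).
    have vN : v \in N by rewrite inE vF e_sym -vws.
    have /forall_inP/(_ v vN)/implyP/(_ ew)/exists_inP[x xF vx] := good.
    by have [z vz] := cf v x vFw xF vx; exists z => //; apply: fxd.
  rewrite (negbTE nvw) in vws.
  have yF : y \in F :\ w.
    rewrite !inE; apply/andP; split; first by apply: contraNneq nvw => <-.
    by case/setU1P: y_or => // ys; rewrite -ys vy in vws.
  by have [z vz] := cf v y vFw yF vy; exists z => //; apply: fxd.
(* Every neighbour of [s] has a single neighbour in [F], which is again a
   neighbour of [s]. *)
have only v x : v \in N -> x \in F -> e v x -> x \in N.
  move=> vN.
  pose Q w u := [forall x in F, e u x ==> (x == w)] && [exists x in F, e u x].
  have [||w wN /andP[/forall_inP Qw _]] :=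
    injective_dependency (N := N) (Q := Q) _ _ vN.
  - move=> w wN; have := allbad w; rewrite /= wN /= => /negbT/forall_inPn[u' u'N].
    rewrite negb_imply => /andP[u'w /exists_inPn no]; exists u' => //.
    apply/andP; split; last first.
      by apply/exists_inP; exists w => //; move: wN; rewrite inE => /andP[].
    apply/forall_inP => y yF; apply/implyP => u'y; apply: contraTT u'y => yw.
    by apply: no; rewrite !inE yw.
  - move=> w w' u' /andP[/forall_inP Qw /exists_inP[y yF u'y]].
    case/andP=> /forall_inP Qw' _.
    have /implyP/(_ u'y)/eqP <- := Qw y yF.
    by have /implyP/(_ u'y)/eqP := Qw' y yF.
  by move=> xF vx; have /implyP/(_ vx)/eqP -> := Qw x xF.
have [f f2 cf] := forest_two_coloring acF.
(* In [N] only [w0] has colour 0, so [s] relies on [w0], while [N] relies on [s]. The rest of [F]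
   has no neighbour in [N] and still sees [f]. *)
pose g v := if v == s then 2 else if v \in N then (v != w0 : nat) else f v.
have gF x : x \in F -> g x < 2.
  move=> xF; rewrite /g; case: eqVneq => [xs|_]; first by rewrite -xs xF in sF.
  by case: ifP => // _; case: (x != w0).
have gs : g s = 2 by rewrite /g eqxx.
exists g; split.
- by move=> v /setU1P[->|/gF]; rewrite ?gs // => /ltnW.
- move=> v y vF yF vy; case: (eqVneq v s) => [->|vs].
    exists w0; apply/reliesP; rewrite setU1r //; split=> // z.
    case/setU1P=> [->|zF sz]; first by rewrite e_irr.
    have neqs x : x \in F -> (x == s) = false.
      by move=> xF; apply: contraNF sF => /eqP <-.
    rewrite /g !neqs // !inE zF sz w0F sw0 /=.
    by rewrite eqxx; case: (eqVneq z w0).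
  have {}vF : v \in F by case/setU1P: vF => // /eqP; rewrite (negbTE vs).
  have [es|ns] := boolP (e v s).
    exists s; apply/reliesP; rewrite gs setU11; split=> // z.
    by case/setU1P=> // zF _ gz; have := gF z zF; rewrite gz.
  have {}yF : y \in F by case/setU1P: yF => // ys; rewrite -ys vy in ns.
  have gE x : x \in F -> e v x -> g x = f x.
    move=> xF vx; rewrite /g; case: eqVneq => [xs|_]; first by rewrite -xs vx in ns.
    case: ifP => // xN; have := only x v xN vF; rewrite e_sym vx => /(_ isT).
    by rewrite inE e_sym (negbTE ns) andbF.
  have [x /reliesP[xF vx unx]] := cf v y vF yF vy; exists x.
  apply/reliesP; rewrite setU1r //; split=> // z.
  case/setU1P=> [->|zF vz]; first by rewrite (negbTE ns).
  by rewrite !gE //; apply: unx.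
- by move=> x y xF _ gx1; have := gF x xF; rewrite ltnNge gx1.
Qed.

(** * Colouring [S :\: U], and the count of colours *)

(** Each vertex of [S :\: U] has a colour of its own, so all its neighbours can rely on it. A vertex
    without such a neighbour lies outside [S] and, within [~: U], sees only the forest. *)
Lemma extend_core S U :
  acyclic_in (~: S) -> U \subset S ->
  (forall u t, u \in U -> t \in S -> ~~ e u t) ->
  (forall t, t \in S :\: U -> exists2 t', t' \in S & e t t') ->
  extendable (~: S) (~: U) (#|S :\: U| + 2).
Proof.
move=> acS /subsetP US noU hasS.
have [f f2 cf] := forest_two_coloring acS.
pose D := S :\: U.
pose g v := if v \in D then (index v (enum D)).+2 else f v.
have gD x y : x \in D -> g y = g x -> y = x.
  rewrite /g => xD; rewrite xD; case: ifP => [yD [] /eqP|_ fy].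
    by move=> /eqP; apply: index_inj; rewrite ?mem_enum.
  by have := f2 y; rewrite fy.
have gF x : x \notin S -> g x = f x by rewrite /g !inE => /negbTE ->; rewrite andbF.
exists g; split.
- move=> v; rewrite /g; case: ifP => [vD _|_ _]; last by have := f2 v; lia.
  by rewrite addn2 !ltnS cardE index_mem mem_enum.
- move=> v y; rewrite !inE => vU yU vy.
  case: (pickP [pred t in D | e v t]) => [t /andP[tD vt]|noD].
    exists t; apply/reliesP; split=> //; last by move=> z _ _; apply: gD.
    by move: tD; rewrite !inE => /andP[].
  have vS : v \notin S.
    apply/negP => vS; have [|t tS vt] := hasS v; first by rewrite !inE vU.
    have := noD t; rewrite /= !inE vt tS !andbT => /negbFE tU.
    by have := noU t v tU vS; rewrite e_sym vt.
  have nS z : z \notin U -> e v z -> z \notin S.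
    by move=> zU vz; apply/negP => zS; have := noD z; rewrite /= !inE zU zS vz.
  have vF : v \in ~: S by rewrite inE.
  have yF : y \in ~: S by rewrite inE nS.
  have [x /reliesP[]] := cf v y vF yF vy.
  rewrite inE => xS vx unx; exists x; apply/reliesP; split=> //.
    by rewrite inE; apply: contra xS; apply: US.
  move=> z; rewrite inE => zU vz; rewrite (gF x) // (gF z) ?(nS z) //.
  by apply: unx => //; rewrite inE nS.
- move=> x y; rewrite !inE => xS yS; rewrite gF // => fx1.
  by have := f2 x; rewrite ltnNge fx1.
Qed.

Lemma extend_all F A m :
  F \subset A -> 2 < m ->
  (forall s, s \notin A -> exists x, e s x) ->
  (forall s x, s \notin A -> e s x -> x \in F) ->
  extendable F A m -> extendable F setT (m + #|~: A|).
Proof.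
have [n] := ubnP #|~: A|; elim: n A m => // n IHn A m ltAn FA m3 exF inF ext.
case: (set_0Vmem (~: A)) => [A0|[s]].
  by rewrite A0 cards0 addn0 -setC0 -A0 setCK.
rewrite inE => sA.
have cardA : #|~: A| = #|~: (s |: A)|.+1.
  rewrite (cardsD1 s) inE sA; congr (_.+1); apply: eq_card => x.
  by rewrite !inE negb_or.
have sub s' : s' \notin s |: A -> s' \notin A.
  by apply: contra => s'A; rewrite inE s'A orbT.
rewrite cardA addnS -addSn; apply: IHn.
- by move: ltAn; rewrite cardA.
- exact: subset_trans FA (subsetU1 _ _).
- exact: ltnW.
- by move=> s' /sub /exF.
- by move=> s' x /sub; apply: inF.
apply: extend_vertex => //; last by move=> x _; apply: inF.
have [x sx] := exF s sA; exists x => //; apply: (subsetP FA); exact: inF sx.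
Qed.

Lemma extendable_CFON_colorable F k :
  no_isolated e -> extendable F setT k -> CFON_colorable e k.
Proof.
move=> /forallP noiso [f [fk cf _]]; apply/existsP.
have fk' v : f v < k by apply: fk.
exists [ffun v => Ordinal (fk' v)]; apply/forallP => v.
have [x] := set0Pn _ (noiso v); rewrite inE => vx.
have [y /reliesP[_ vy uny]] := cf v x (in_setT _) (in_setT _) vx.
apply/existsP; exists (Ordinal (fk' y)); apply/cards1P; exists y.
apply/setP => z; rewrite !inE ffunE -val_eqE /=.
apply/andP/eqP => [[vz /eqP fz]|->]; last by rewrite vy eqxx.
exact: uny.
Qed.

Lemma fvs_colorable S :
  no_isolated e -> acyclic_in (~: S) -> CFON_colorable e (#|S| + 2).
Proof.
move=> noiso acS; have exnb v : exists x, e v x.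
  by have /set0Pn[x] := forallP noiso v; rewrite inE; exists x.
pose U := [set u in S | [forall t in S, ~~ e u t]].
have US : U \subset S by apply/subsetP => u; rewrite inE => /andP[].
have noU u t : u \in U -> t \in S -> ~~ e u t.
  by rewrite inE => /andP[_ /forall_inP]; apply.
have hasS t : t \in S :\: U -> exists2 t', t' \in S & e t t'.
  rewrite !inE => /andP[+ tS]; rewrite tS => /forall_inPn[t' t'S].
  by rewrite negbK; exists t'.
have US_F s x : s \in U -> e s x -> x \in ~: S.
  by move=> sU sx; rewrite inE; apply: contraTN sx; apply: noU.
have cardS : #|S| = #|S :\: U| + #|U|.
  by rewrite -(cardsID U S) (setIidPr US) addnC.
have core := extend_core acS US noU hasS.
(* [extend_all] must start from more than two colours, which the core provides only if [S :\: U] is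
   nonempty. *)
have [D0|] := eqVneq #|S :\: U| 0; last first.
  rewrite -lt0n => D0; apply: (@extendable_CFON_colorable (~: S)) => //.
  rewrite cardS addnAC -{2}[U]setCK; apply: extend_all => //.
  - by rewrite setCS.
  - by rewrite addn2.
  - by move=> s x; rewrite inE negbK; apply: US_F.
(* If [U] is empty too, so is [S], and the two forest colours suffice. *)
case: (set_0Vmem U) => [U0|[s sU]].
  apply: (@extendable_CFON_colorable (~: S)) => //.
  by rewrite cardS U0 cards0 addn0; move: core; rewrite U0 setC0.
have SU : S = U.
  by apply/eqP; rewrite eqEsubset US andbT -setD_eq0 -cards_eq0 D0.
have sF : s \notin ~: S by rewrite inE negbK SU.
apply: (@extendable_CFON_colorable (~: S)) => //.
(* The third colour of [extend_forest] pays for [s]; each other vertex of [U] pays for one more. *)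
have -> : #|S| + 2 = 3 + #|~: (s |: ~: S)|.
  rewrite setCU setCK setIC -setDE SU (cardsD1 s U) sU; lia.
have inU v : v \notin s |: ~: S -> v \in U.
  by rewrite in_setU1 in_setC negb_or negbK SU => /andP[].
apply: extend_all => //.
- exact: subsetU1.
- by move=> v x /inU; apply: US_F.
apply: extend_forest => //.
by have [x sx] := exnb s; exists x => //; apply: US_F sx.
Qed.

End ConflictFree.

Theorem theorem9 (V : finType) (e : rel V)
    (e_sym : symmetric e) (e_irr : irreflexive e)
    (e_conn : connected_graph e) (e_noiso : no_isolated e) :
  chi_ON e_noiso <= fvs e + 2.
Proof.
have [[S fvsS <-] _] := fvsP e.
rewrite /chi_ON; case: ex_minnP => k _; apply.
by apply: fvs_colorable => //; apply: fvs_acyclic_in.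
Qed.
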